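(* Let $A \in \mathbb{R}^{n \times n}$ satisfy at least one of the following: (a) $A$ is Metzler; (b) $A$ is tridiagonal of the form $$A = \begin{pmatrix} a_{1} & u_{1} & 0 & \cdots & 0 & 0 \\ l_{1} & a_{2}& u_{2} & \cdots & 0 &0 \\ 0 & l_{2} & a_{3} & \cdots & 0 & 0\\ \vdots & \vdots & \vdots & \ddots & \vdots & \vdots \\ 0 & 0 & 0 & \cdots & a_{n-1} & u_{n-1}\\ 0 & 0 & 0 & \cdots & l_{n-1} & a_{n} \end{pmatrix}$$ with $l_iu_i \ge 0$ for $i = 1,\ldots,n-1$; (c) $A$ is of the form $$A = \begin{pmatrix} a_{1} & 0 & 0 & \cdots & 0 & 0 \\ 0 & a_{2}& 0 & \cdots & 0 &0 \\ 0 & 0 & a_{3} & \cdots & 0 & 0\\ \vdots & \vdots & \vdots & \ddots & \vdots & \vdots \\ 0 & 0 & 0 & \cdots & a_{n-1} & 0\\ c_{1} & c_{2} & c_{3} & \cdots & c_{n-1} & a_{n} \end{pmatrix}.$$ Let $B\in\mathbb{R}^{n\times n}$ be of the form $$B =\begin{pmatrix} 0 & b_{1} & 0 & \cdots & 0 & 0 \\ 0 & 0& b_{2} & \cdots & 0 &0 \\ 0 & 0 & 0 & \cdots & 0 & 0\\ \vdots & \vdots & \vdots & \ddots & \vdots & \vdots \\ 0 & 0 & 0 & \cdots & 0 & b_{n-1}\\ 0 & 0 & 0 & \cdots & 0 & 0 \end{pmatrix},$$ i.e. the only possibly non-zero entries of $B$ are the $(i,i+1)$ entries $b_i$, $1 \le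 i \le n-1$. Then the pair $(A, B)$ is diagonally Riccati stable if and only if $\hat A + \bar B$ is Hurwitz.
   Context: $M \succ 0$ ($M \prec 0$) means that the real matrix $M=M^T$ is positive definite (negative definite). A pair $(A,B)$ of matrices in $\mathbb{R}^{n\times n}$ is diagonally Riccati stable if there exist diagonal $P \succ 0$, $Q \succ 0$ in $\mathbb{R}^{n \times n}$ with $A^TP+PA + Q + PBQ^{-1}B^TP \prec 0$. $A\in\mathbb{R}^{n\times n}$ is Metzler if $a_{ij}\ge 0$ for all $i \neq j$. A real square matrix is Hurwitz if all its eigenvalues have negative real part. For $C \in \mathbb{R}^{n\times n}$, $\hat C$ is the matrix with $\hat c_{ii}=c_{ii}$ and $\hat c_{ij}=|c_{ij}|$ for $i\neq j$, and $\bar C$ is the matrix with $\bar c_{ij}=|c_{ij}|$ for all $i,j$. *)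

(* Defs.v *)
From mathcomp Require Import all_boot all_order all_algebra.
From mathcomp Require Import reals complex.

Set Implicit Arguments.
Unset Strict Implicit.
Unset Printing Implicit Defensive.

Import Order.TTheory GRing.Theory Num.Theory.
Local Open Scope ring_scope.

Section Definitions.

Variables (R : realType) (n : nat).
Implicit Types A B C M P Q : 'M[R]_n.

Definition posdefmx M : Prop :=
  M^T = M /\ forall x : 'cV[R]_n, x != 0 -> 0 < (x^T *m M *m x) 0 0.

Definition negdefmx M : Prop :=
  M^T = M /\ forall x : 'cV[R]_n, x != 0 -> (x^T *m M *m x) 0 0 < 0.

(* [Q] is positive definite, hence invertible, so [invmx Q] is the genuine
   inverse of [Q]. *)
Definition diag_riccati_stable A B : Prop :=
  exists P Q, [/\ is_diag_mx P, is_diag_mx Q, posdefmx P, posdefmx Q &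
    negdefmx (A^T *m P + P *m A + Q + P *m B *m invmx Q *m B^T *m P)].

Definition metzler A : Prop := forall i j, i != j -> 0 <= A i j.

(* The eigenvalues of a real matrix are taken in the complex numbers [R[i]]. *)
Definition hurwitz A : Prop :=
  forall z : R[i], eigenvalue (map_mx (real_complex R) A) z -> complex.Re z < 0.

Definition hatmx C : 'M[R]_n :=
  \matrix_(i, j) if i == j then C i j else `|C i j|.

Definition barmx C : 'M[R]_n := map_mx (fun c : R => `|c|) C.

(* [l_i] and [u_i] are the entries (i+1, i) and (i, i+1) of [A]. *)
Definition sign_sym_tridiag A : Prop :=
  (forall i j : 'I_n, (i.+1 < j)%N || (j.+1 < i)%N -> A i j = 0) /\
  (forall i j : 'I_n, j = i.+1 :> nat -> 0 <= A j i * A i j).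

Definition diag_plus_last_row A : Prop :=
  forall i j : 'I_n, i != j -> i.+1 != n -> A i j = 0.

Definition superdiagonal B : Prop :=
  forall i j : 'I_n, j != i.+1 :> nat -> B i j = 0.

End Definitions.

(* Main.v *)
Require Import Defs.
From mathcomp Require Import all_boot all_order all_algebra.
From mathcomp Require Import boolp classical_sets.
From mathcomp Require Import reals complex.
From mathcomp Require Import zify ring lra.

(** Write [M] for the Metzler matrix [hatmx A + barmx B].  Each column of [B]
    has at most one nonzero entry, so [P B Q^-1 B^T P] is diagonal and, with
    [P = diag p] and [Q = diag q], the Riccati matrix has the quadratic form
      [sum_ij (2 p_i a_ij x_i x_j + (p_i b_ij x_i)^2 / q_j) + sum_j q_j x_j^2],
    called [riccati_form A B p q x] below.  Stability of the pair means that,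
    for some positive [p] and [q], it is negative for all [x <> 0]
    ([diag_riccati_stableP]).

    Hurwitz implies stable.  A Hurwitz Metzler matrix
    admits positive vectors [v] and [w] with [M v < 0] and [w^T M < 0]
    ([metzler_hurwitz_semipositive]).  Put [p_i = w_i / v_i] and
    [q_j = - (w^T hatmx A)_j / v_j].  Bounding each cross term [a_ij x_i x_j] by
    the AM-GM inequality that is tight at [|x| = v], and each [B]-term through
    [w_i |b_ij| <= q_j v_j], all the terms in [w^T hatmx A] cancel and what
    remains is [sum_i p_i (M v)_i / v_i x_i^2 < 0] ([hurwitz_riccati_form]).

    Stable implies Hurwitz.  In each of the three cases a diagonal matrix [S]
    of signs satisfies [S A S = hatmx A]: the graph of the off-diagonal entries
    is a path or a star, along which signs can be chosen one vertex at a time,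
    or all these entries are nonnegative already.  Since the [B]-terms only
    involve squares, replacing [x] by [S x] turns [A] into [hatmx A] in the form
    ([riccati_form_flip]).  A second use of AM-GM, now
    [2 p_i |b_ij| x_i x_j <= q_j x_j^2 + (p_i b_ij x_i)^2 / q_j], gives
    [2 x^T P M x <= riccati_form (hatmx A) B p q x < 0]
    ([riccati_form_bound]), and [M] is Hurwitz by Lyapunov's argument
    ([lyapunov_hurwitz]). *)

Set Implicit Arguments.
Unset Strict Implicit.
Unset Printing Implicit Defensive.

Import Order.TTheory GRing.Theory Num.Theory.
Local Open Scope ring_scope.

(** * Positive vectors for Hurwitz Metzler matrices *)

(** At an index minimizing [x_i / v_i], if that ratio [c] were negative, the
    vector [x - c v] would be nonnegative and vanish at [i], contradicting the
    sign of the [i]-th entry of [(t - M) (x - c v)]. *)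
Lemma metzler_monotone (R : realType) n (M : 'M[R]_n) t (v x : 'I_n -> R) :
  metzler M -> (forall i, 0 < v i) ->
  (forall i, \sum_j M i j * v j < t * v i) ->
  (forall i, \sum_j M i j * x j <= t * x i) -> forall i, 0 <= x i.
Proof.
move=> Mm v0 Mv Mx i0.
case: (@arg_minP _ _ _ i0 xpredT (fun j => x j / v j)) => // i _ imin.
have {imin} ymin j : x i / v i * v j <= x j.
  by rewrite -ler_pdivlMr//; exact: imin.
have xi : x i / v i * v i = x i by rewrite divfK// gt_eqF.
suff : 0 <= x i / v i.
  by move=> c0; apply: le_trans (ymin i0); rewrite mulr_ge0// ltW.
rewrite leNgt; apply/negP; set c := x i / v i => c0.
have : 0 <= \sum_j M i j * (x j - c * v j).
  apply: sumr_ge0 => j _; have [<-|ij] := eqVneq i j.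
    by rewrite xi subrr mulr0.
  by rewrite mulr_ge0 ?Mm// subr_ge0 ymin.
have -> : \sum_j M i j * (x j - c * v j) =
    \sum_j M i j * x j - c * \sum_j M i j * v j.
  rewrite mulr_sumr -sumrB; apply: eq_bigr => j _; ring.
have : c * (t * v i) < c * \sum_j M i j * v j by rewrite ltr_nM2l.
by rewrite mulrCA xi; have := Mx i; lra.
Qed.

Lemma metzler_strict_gt0 (R : realType) n (M : 'M[R]_n) t (v : 'I_n -> R) :
  metzler M -> (forall i, 0 <= v i) ->
  (forall i, \sum_j M i j * v j < t * v i) -> forall i, 0 < v i.
Proof.
move=> Mm v0 Mv i; rewrite lt_neqAle v0 andbT eq_sym; apply/eqP => vi0.
have := Mv i; rewrite vi0 mulr0 ltNge => /negP; apply.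
apply: sumr_ge0 => j _; have [<-|ij] := eqVneq i j; first by rewrite vi0 mulr0.
by rewrite mulr_ge0 ?Mm.
Qed.

Lemma exists_small_scale (R : realType) n (f : 'I_n -> R) :
  exists2 e : R, 0 < e & forall i, e * `|f i| < 1.
Proof.
have s0 : 0 <= \sum_i `|f i| by apply: sumr_ge0.
exists (1 + \sum_i `|f i|)^-1; first by rewrite invr_gt0; lra.
move=> i; rewrite mulrC ltr_pdivrMr ?mul1r; last by lra.
rewrite (bigD1 i)//= in s0 *.
have : 0 <= \sum_(j < n | j != i) `|f j| by apply: sumr_ge0.
by lra.
Qed.

(** The set [T] of the [t >= 0] for which some [v > 0] has [t v - M v > 0]
    contains all large [t]; the claim is that its infimum [t0] belongs to it and
    is [0].  The natural candidate at [t0] is the solution [v] of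
    [t0 v - M v = 1].  The right-hand side stays nonnegative when [t0] is
    replaced by a close enough [t] in [T], which forces [v >= 0] by
    monotonicity; and it stays positive when [t0] is slightly decreased, which
    is incompatible with [t0 > 0]. *)
Lemma metzler_semipositive (R : realType) n (M : 'M[R]_n) :
  metzler M -> (forall t, 0 <= t -> t%:M - M \in unitmx) ->
  exists2 v : 'I_n -> R, forall i, 0 < v i & forall i, \sum_j M i j * v j < 0.
Proof.
move=> Mm Mu.
pose dom t (v : 'I_n -> R) :=
  (forall i, 0 < v i) /\ (forall i, \sum_j M i j * v j < t * v i).
pose T : set R := fun t => 0 <= t /\ exists v, dom t v.
suff [v [v0 Mv]] : exists v, dom 0 v.
  by exists v => // i; have := Mv i; rewrite mul0r.
have T0 : nonempty T.
  have s0 : 0 <= \sum_i \sum_j `|M i j|.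
    by apply: sumr_ge0 => i _; apply: sumr_ge0.
  exists (1 + \sum_i \sum_j `|M i j|); split; first lra.
  exists (fun=> 1); split => // i; rewrite mulr1.
  have : \sum_j M i j * 1 <= \sum_j `|M i j|.
    by apply: ler_sum => j _; rewrite mulr1 ler_norm.
  have : \sum_j `|M i j| <= \sum_i \sum_j `|M i j|.
    rewrite [leRHS](bigD1 i)//= lerDl.
    by apply: sumr_ge0 => k _; apply: sumr_ge0.
  lra.
have Tlb : lbound T 0 by move=> t [].
set t0 := inf T.
have t00 : 0 <= t0 by apply: lb_le_inf.
have sol : exists v : 'I_n -> R, forall i, t0 * v i - \sum_j M i j * v j = 1.
  have := mulKVmx (Mu _ t00) (const_mx 1 : 'cV_n).
  move: (invmx _ *m _) => u; rewrite mulmxBl mul_scalar_mx => Eu.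
  exists (fun i => u i 0) => i.
  by move/matrixP: Eu => /(_ i 0); rewrite !mxE.
case: sol => v solv.
have [e e0 ev] := exists_small_scale v.
have v0 : forall i, 0 <= v i.
  have [t [tT [u [u0 Mu0]]]] : exists2 t, T t & t < t0 + e.
    by apply: inf_adherent => //; split => //; exists 0.
  move=> tlt; have t0t : t0 <= t.
    by apply: ge_inf => //; [exists 0|split=> //; exists u].
  apply: (@metzler_monotone _ _ M t u v) => // i.
  have := solv i; have := ev i; have := normr_ge0 (v i).
  have := ler_norm (- v i); rewrite normrN.
  have d0 : 0 <= t - t0 by lra.
  have d1 : t - t0 <= e by lra.
  move=> h1 h2 h3 h4.
  suff : (t - t0) * - v i <= 1 by rewrite mulrN mulrBl; lra.
  apply: le_trans (ltW h3); apply: (@le_trans _ _ ((t - t0) * `|v i|)).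
    by rewrite ler_wpM2l.
  by rewrite ler_wpM2r.
have vlt i : \sum_j M i j * v j < t0 * v i by have := solv i; lra.
have vpos := @metzler_strict_gt0 _ _ M t0 v Mm v0 vlt.
have [t0eq|t0ne] := eqVneq t0 0.
  by exists v; split=> // i; rewrite -[X in X * _]t0eq.
have t0gt : 0 < t0 by rewrite lt_neqAle eq_sym t0ne.
(* Capping the decrement at [t0] keeps [t0 - d] nonnegative. *)
pose d := Num.min e t0.
have d0 : 0 < d by rewrite lt_min e0.
have dt : d <= t0 by rewrite ge_min lexx orbT.
have de : d <= e by rewrite ge_min lexx.
suff : T (t0 - d).
  by move/(ge_inf (ex_intro _ 0 Tlb)); rewrite -/t0; lra.
split; first lra.
exists v; split => // i.
have := solv i; have := ev i; rewrite ger0_norm// => h1 h2.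
have : d * v i <= e * v i by rewrite ler_wpM2r.
by rewrite mulrBl; lra.
Qed.

Lemma hurwitz_unitmx (R : realType) n (M : 'M[R]_n) :
  hurwitz M -> forall t : R, 0 <= t -> t%:M - M \in unitmx.
Proof.
move=> hM t t0; rewrite unitmxE unitfE; apply/negP => /det0P[u u0 Mu].
have : eigenvalue M t.
  apply/eigenvalueP; exists u => //; apply/eqP.
  by rewrite -mul_mx_scalar eq_sym -subr_eq0 -mulmxBr Mu.
rewrite -(eigenvalue_map (real_complex R)) => /hM /=; lra.
Qed.

Lemma metzler_hurwitz_semipositive (R : realType) n (M : 'M[R]_n) :
  metzler M -> hurwitz M ->
  exists v w : 'I_n -> R,
    [/\ forall i, 0 < v i, forall i, \sum_j M i j * v j < 0,
        forall i, 0 < w i & forall j, \sum_i w i * M i j < 0].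
Proof.
move=> Mm /hurwitz_unitmx Mu.
have [v v0 Mv] := metzler_semipositive Mm Mu.
have [||w w0 Mw] := @metzler_semipositive _ _ M^T.
- by move=> i j ij; rewrite mxE Mm// eq_sym.
- by move=> t t0; rewrite -tr_scalar_mx -linearB unitmx_tr Mu.
exists v, w; split => // j.
by have := Mw j; under eq_bigr do rewrite mxE mulrC.
Qed.

(** * The quadratic form of the Riccati matrix *)

(** The quadratic form of [riccatimx A B P Q] below, for [P = diag p] and
    [Q = diag q], when [B] has at most one nonzero entry in each column. *)
Definition riccati_form (R : realType) n (A B : 'M[R]_n) (p q x : 'I_n -> R) :=
  \sum_i \sum_j (2 * (p i * A i j * x i * x j) + (p i * B i j * x i) ^+ 2 / q j)
  + \sum_j q j * x j ^+ 2.

Lemma qformE (R : realType) n (M : 'M[R]_n) (x : 'cV[R]_n) :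
  (x^T *m M *m x) 0 0 = \sum_i \sum_j x i 0 * M i j * x j 0.
Proof.
rewrite exchange_big mxE; apply: eq_bigr => j _.
by rewrite mxE mulr_suml; apply: eq_bigr => i _; rewrite mxE.
Qed.

Lemma posdef_diagP (R : realType) n (d : 'rV[R]_n) :
  posdefmx (diag_mx d) <-> forall i, 0 < d 0 i.
Proof.
have form (x : 'cV[R]_n) :
    (x^T *m diag_mx d *m x) 0 0 = \sum_i d 0 i * x i 0 ^+ 2.
  rewrite mul_mx_diag mxE; apply: eq_bigr => i _; rewrite !mxE; ring.
split=> [[_ dpos] i|d0]; last first.
  split; [exact: tr_diag_mx | move=> x /cV0Pn[i xi]].
  rewrite form (bigD1 i)//= ltr_wpDr//; last first.
    by apply: mulr_gt0 => //; rewrite exprn_even_gt0.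
  by apply: sumr_ge0 => j _; rewrite mulr_ge0 ?sqr_ge0// ltW.
have := dpos (delta_mx i 0).
rewrite form (bigD1 i)//= big1 => [|j ji]; last first.
  by rewrite mxE (negPf ji) expr0n mulr0.
rewrite mxE !eqxx expr1n mulr1 addr0; apply.
by apply/cV0Pn; exists i; rewrite mxE !eqxx oner_eq0.
Qed.

Lemma invmx_diag (R : realType) n (d : 'rV[R]_n) :
  (forall i, d 0 i != 0) -> invmx (diag_mx d) = diag_mx (\row_i (d 0 i)^-1).
Proof.
move=> d0.
have E : diag_mx (\row_i (d 0 i)^-1) *m diag_mx d = 1%:M.
  rewrite mulmx_diag -diag_const_mx; congr diag_mx.
  by apply/rowP => i; rewrite !mxE mulVf.
have [_ du] := mulmx1_unit E.
by rewrite -[LHS]mul1mx -E -mulmxA mulmxV// mulmx1.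
Qed.

(** The feature of a superdiagonal matrix which makes [B Q^-1 B^T] diagonal for
    every diagonal [Q]. *)
Definition mono_columns (R : realType) n (B : 'M[R]_n) :=
  forall i k j, B i j != 0 -> B k j != 0 -> i = k.

Lemma superdiagonal_mono_columns (R : realType) n (B : 'M[R]_n) :
  superdiagonal B -> mono_columns B.
Proof.
move=> hB i k j Bij Bkj; apply: val_inj => /=; apply: succn_inj.
have [<-//|/hB E] := eqVneq (j : nat) i.+1; last by rewrite E eqxx in Bij.
by have [//|/hB E] := eqVneq (j : nat) k.+1; rewrite E eqxx in Bkj.
Qed.

Definition riccatimx (R : realType) n (A B P Q : 'M[R]_n) :=
  A^T *m P + P *m A + Q + P *m B *m invmx Q *m B^T *m P.

Lemma riccatimxE (R : realType) n (A B : 'M[R]_n) (p q : 'rV[R]_n) i k :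
  mono_columns B -> (forall i, 0 < q 0 i) ->
  riccatimx A B (diag_mx p) (diag_mx q) i k =
  p 0 i * A i k + p 0 k * A k i +
  (q 0 i + \sum_j (p 0 i * B i j) ^+ 2 / q 0 j) *+ (i == k).
Proof.
move=> hB q0; rewrite /riccatimx invmx_diag => [|j]; last by rewrite gt_eqF.
rewrite !(mul_mx_diag, mul_diag_mx) !mxE mulrnDl.
under [X in _ + X * _ = _]eq_bigr do rewrite !mxE.
suff -> : (\sum_j p 0 i * B i j * (q 0 j)^-1 * B k j) * p 0 k =
    (\sum_j (p 0 i * B i j) ^+ 2 / q 0 j) *+ (i == k) by ring.
rewrite mulr_suml; have [<-|ik] := eqVneq i k.
  by apply: eq_bigr => j _; ring.
apply: big1 => j _.
have [->|Bij] := eqVneq (B i j) 0; first by rewrite !(mulr0, mul0r).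
have [->|Bkj] := eqVneq (B k j) 0; first by rewrite !(mulr0, mul0r).
by rewrite (hB _ _ _ Bij Bkj) eqxx in ik.
Qed.

Lemma riccati_formE (R : realType) n (A B : 'M[R]_n) (p q : 'rV[R]_n)
    (x : 'cV[R]_n) :
  mono_columns B -> (forall i, 0 < q 0 i) ->
  (x^T *m riccatimx A B (diag_mx p) (diag_mx q) *m x) 0 0 =
  riccati_form A B (p 0) (q 0) (fun i => x i 0).
Proof.
move=> hB q0; rewrite qformE /riccati_form.
under eq_bigr do under eq_bigr do rewrite riccatimxE//.
pose a i k := p 0 i * A i k * x i 0 * x k 0.
pose d i := q 0 i + \sum_j (p 0 i * B i j) ^+ 2 / q 0 j.
transitivity (\sum_i (\sum_k a i k + \sum_k a k i + d i * x i 0 ^+ 2)).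
  apply: eq_bigr => i _.
  have -> : d i * x i 0 ^+ 2 = \sum_k (d i * x i 0 * x k 0) *+ (i == k).
    rewrite (bigD1 i)//= eqxx big1 ?addr0 => [|k ki]; first by rewrite mulr1n; ring.
    by rewrite eq_sym (negPf ki).
  rewrite -!big_split; apply: eq_bigr => k _ /=.
  by rewrite /a -/(d i); case: eqVneq => _; rewrite ?mulr1n ?mulr0n; ring.
rewrite !big_split /= [X in _ + X + _]exchange_big /= -big_split /= -!big_split /=.
apply: eq_bigr => i _.
rewrite big_split /= -mulr_sumr -/(a _) /d mulrDl mulr_suml.
rewrite (_ : \sum_j (p 0 i * B i j * x i 0) ^+ 2 / q 0 j =
  \sum_j (p 0 i * B i j) ^+ 2 / q 0 j * x i 0 ^+ 2); first by rewrite /a; ring.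
by apply: eq_bigr => j _; ring.
Qed.

Lemma diag_riccati_stableP (R : realType) n (A B : 'M[R]_n) :
  mono_columns B ->
  diag_riccati_stable A B <->
  exists p q : 'I_n -> R, [/\ forall i, 0 < p i, forall i, 0 < q i &
    forall x, (exists i, x i != 0) -> riccati_form A B p q x < 0].
Proof.
move=> hB; split.
  move=> [P [Q [/diag_mxP[p ->] /diag_mxP[q ->] /posdef_diagP p0]]].
  move=> /posdef_diagP q0 [_ neg]; exists (p 0), (q 0); split=> // x [i xi].
  have := neg (\col_i x i); rewrite riccati_formE//.
  rewrite (_ : (fun _ => _) = x); last by apply/funext => k; rewrite mxE.
  by apply; apply/cV0Pn; exists i; rewrite mxE.
move=> [p [q [p0 q0 neg]]].
have Ep : (\row_i p i) 0 = p by apply/funext => i; rewrite mxE.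
have Eq : (\row_i q i) 0 = q by apply/funext => i; rewrite mxE.
exists (diag_mx (\row_i p i)), (diag_mx (\row_i q i)).
split; rewrite ?diag_mx_is_diag// ?posdef_diagP ?Ep ?Eq//.
rewrite -/(riccatimx _ _ _ _); split=> [|x /cV0Pn[i xi]].
  apply/matrixP => i k; rewrite mxE !riccatimxE ?Eq//.
  by rewrite eq_sym [X in X + _]addrC; case: eqVneq => [->|].
by rewrite riccati_formE ?Ep ?Eq//; apply: neg; exists i.
Qed.

(** * Hurwitz implies diagonal Riccati stability *)

Lemma hatmx_metzler (R : realType) n (A : 'M[R]_n) : metzler (hatmx A).
Proof. by move=> i j ij; rewrite mxE (negPf ij). Qed.

Lemma metzlerD_ge0 (R : realType) n (A B : 'M[R]_n) :
  metzler A -> (forall i j, 0 <= B i j) -> metzler (A + B).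
Proof. by move=> mA B0 i j ij; rewrite mxE addr_ge0 ?mA. Qed.

(** In the variables [x / v] and [y / w] this is [2 s t <= s^2 + t^2]. *)
Lemma le_weighted_amgm (R : realType) (a b v w x y : R) :
  0 < v -> 0 < w -> `|a| <= b ->
  2 * (a * x * y) <= b * (w / v * x ^+ 2 + v / w * y ^+ 2).
Proof.
move=> v0 w0 ab; pose s := x / v; pose t := y / w.
have -> : x = v * s by rewrite /s mulrC divfK ?gt_eqF.
have -> : y = w * t by rewrite /t mulrC divfK ?gt_eqF.
have -> : w / v * (v * s) ^+ 2 + v / w * (w * t) ^+ 2 =
    v * w * (s ^+ 2 + t ^+ 2) by field; rewrite !gt_eqF.
have -> : 2 * (a * (v * s) * (w * t)) = v * w * (a * (2 * s * t)) by ring.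
rewrite [leRHS]mulrCA ler_pM2l ?mulr_gt0//.
apply: le_trans (ler_norm _) _; rewrite normrM; apply: ler_pM => //.
have := sqr_ge0 (s - t); have := sqr_ge0 (s + t).
by rewrite ler_norml !expr2 => ? ?; apply/andP; split; lra.
Qed.

(** The choice of [q] makes the [w]-part of the bounds on the [A]-terms cancel
    [sum_j q_j x_j^2] exactly, while [w^T M < 0] gives both [q > 0] and
    [w_i |b_ij| <= q_j v_j], which bounds the [B]-terms by the [B]-part of
    [p_i (M v)_i / v_i x_i^2]. *)
Lemma hurwitz_riccati_form (R : realType) n (A B : 'M[R]_n) :
  hurwitz (hatmx A + barmx B) ->
  exists p q : 'I_n -> R, [/\ forall i, 0 < p i, forall i, 0 < q i &
    forall x, (exists i, x i != 0) -> riccati_form A B p q x < 0].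
Proof.
move=> hM; set M := hatmx A + barmx B.
have barB_ge0 i j : 0 <= barmx B i j by rewrite mxE.
have ME i j : M i j = hatmx A i j + `|B i j| by rewrite mxE [X in _ + X]mxE.
have [v [w [v0 Mv w0 wM]]] :=
  metzler_hurwitz_semipositive (metzlerD_ge0 (@hatmx_metzler _ _ A) barB_ge0) hM.
rewrite -/M in Mv wM.
pose p i := w i / v i.
pose q j := - (\sum_i w i * hatmx A i j) / v j.
have wE j : \sum_i w i * M i j = \sum_i w i * hatmx A i j + \sum_i w i * `|B i j|.
  by rewrite -big_split; apply: eq_bigr => i _; rewrite ME mulrDr.
have wB_ge0 j : 0 <= \sum_i w i * `|B i j|.
  by apply: sumr_ge0 => i _; rewrite mulr_ge0// ltW.
have q0 j : 0 < q j.
  by rewrite divr_gt0//; have := wM j; have := wB_ge0 j; rewrite wE; lra.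
have qB i j : w i * `|B i j| <= q j * v j.
  rewrite divfK ?gt_eqF//; have := wM j.
  rewrite wE (bigD1 (F := fun i => w i * `|B i j|) i)//=.
  have : 0 <= \sum_(k < n | k != i) w k * `|B k j|.
    by apply: sumr_ge0 => k _; rewrite mulr_ge0// ltW.
  by lra.
exists p, q; split=> // [i|x [i0 xi0]]; first by rewrite divr_gt0.
have Bterm i j : (p i * B i j * x i) ^+ 2 / q j <=
    p i * `|B i j| * v j / v i * x i ^+ 2.
  rewrite ler_pdivrMr//; set k := w i * `|B i j| * (x i / v i) ^+ 2.
  have -> : (p i * B i j * x i) ^+ 2 = k * (w i * `|B i j|).
    rewrite /k /p !exprMn -(real_normK (num_real (B i j))); ring.
  have -> : p i * `|B i j| * v j / v i * x i ^+ 2 * q j = k * (q j * v j).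
    by rewrite /k /p !exprMn; ring.
  apply: ler_wpM2l (qB i j).
  by apply: mulr_ge0 (sqr_ge0 _); rewrite mulr_ge0// ltW.
have Aterm i j : 2 * (p i * A i j * x i * x j) <=
    p i * hatmx A i j * v j / v i * x i ^+ 2
      + w i * hatmx A i j / v j * x j ^+ 2.
  have -> : p i * hatmx A i j * v j / v i * x i ^+ 2
      + w i * hatmx A i j / v j * x j ^+ 2 =
      p i * (hatmx A i j * (v j / v i * x i ^+ 2 + v i / v j * x j ^+ 2)).
    by rewrite /p; field; rewrite !gt_eqF.
  have -> : 2 * (p i * A i j * x i * x j) = p i * (2 * (A i j * x i * x j)) by ring.
  rewrite ler_wpM2l//; first by rewrite ltW// divr_gt0.
  (* A diagonal entry may be negative, but its bound is an equality. *)
  rewrite mxE; have [<-|ij] := eqVneq i j; last exact: le_weighted_amgm.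
  by rewrite divff ?gt_eqF// le_eqVlt; apply/orP; left; apply/eqP; ring.
pose g i := \sum_j M i j * v j.
have : riccati_form A B p q x <= \sum_i p i * g i / v i * x i ^+ 2.
  have -> : \sum_i p i * g i / v i * x i ^+ 2 =
      \sum_i \sum_j (p i * hatmx A i j * v j / v i * x i ^+ 2
        + w i * hatmx A i j / v j * x j ^+ 2
        + p i * `|B i j| * v j / v i * x i ^+ 2) + \sum_j q j * x j ^+ 2.
    have -> : \sum_j q j * x j ^+ 2 =
        - \sum_i \sum_j w i * hatmx A i j / v j * x j ^+ 2.
      rewrite exchange_big -sumrN; apply: eq_bigr => j _ /=.
      by rewrite /q mulNr mulNr mulr_suml mulr_suml.
    apply: (canRL (addrK _)); rewrite -big_split.
    apply: eq_bigr => i _; rewrite /g mulr_sumr mulr_suml mulr_suml -big_split /=.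
    by apply: eq_bigr => j _; rewrite ME; ring.
  rewrite lerD2r; apply: ler_sum => i _; apply: ler_sum => j _.
  exact: lerD.
move=> /le_lt_trans; apply.
have term_lt0 i : p i * g i / v i < 0.
  by rewrite pmulr_llt0 ?invr_gt0// pmulr_rlt0 ?divr_gt0//; exact: Mv.
rewrite (bigD1 i0)//= ltr_wnDr//.
  by apply: sumr_le0 => i _; rewrite mulr_le0_ge0 ?sqr_ge0// ltW.
by rewrite pmulr_llt0// exprn_even_gt0.
Qed.

(** * Diagonal Riccati stability implies Hurwitz *)

(** Let [a + i b] be a row eigenvector of [M] for [z].  Substituting
    [x = P^-1 a] and [x = P^-1 b] in the form and adding, the imaginary part of
    [z] cancels and what remains is [Re z * (a P^-1 a^T + b P^-1 b^T)]. *)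
Lemma lyapunov_hurwitz (R : realType) n (M : 'M[R]_n) (p : 'I_n -> R) :
  (forall i, 0 < p i) ->
  (forall x, (exists i, x i != 0) -> \sum_i \sum_j p i * M i j * x i * x j < 0) ->
  hurwitz M.
Proof.
move=> p0 neg z /eigenvalueP[u uM u0].
pose a i := complex.Re (u 0 i); pose b i := complex.Im (u 0 i).
pose r := complex.Re z; pose s := complex.Im z; rewrite -/r.
have uMj j : \sum_i u 0 i * real_complex R (M i j) = z * u 0 j.
  move/matrixP: uM => /(_ 0 j); rewrite !mxE => <-.
  by apply: eq_bigr => i _; rewrite mxE.
have Ea j : \sum_i a i * M i j = r * a j - s * b j.
  have := congr1 (@complex.Re R) (uMj j).
  rewrite (big_morph _ (_ : {morph @complex.Re R : x y / x + y}) (erefl _)).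
    rewrite /a /b /r /s; case: (z) (u 0 j) => [? ?] [? ?] /= <-.
    by apply: eq_bigr => i _; case: (u 0 i) => ? ? /=; ring.
  by move=> [? ?] [? ?].
have Eb j : \sum_i b i * M i j = r * b j + s * a j.
  have := congr1 (@complex.Im R) (uMj j).
  rewrite (big_morph _ (_ : {morph @complex.Im R : x y / x + y}) (erefl _)).
    rewrite /a /b /r /s; case: (z) (u 0 j) => [? ?] [? ?] /= <-.
    by apply: eq_bigr => i _; case: (u 0 i) => ? ? /=; ring.
  by move=> [? ?] [? ?].
(* The form of [p_i m_ij] in the variables [y = P x]. *)
pose F (y : 'I_n -> R) := \sum_i \sum_j y i * M i j * (y j / p j).
have FE y : F y = \sum_j (\sum_i y i * M i j) * (y j / p j).
  by rewrite /F exchange_big; apply: eq_bigr => j _; rewrite mulr_suml.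
have Fneg y : (exists i, y i != 0) -> F y < 0.
  move=> [i yi]; have := neg (fun i => y i / p i).
  rewrite (_ : \sum_i _ = F y); last first.
    apply: eq_bigr => k _; apply: eq_bigr => j _.
    by field; rewrite !gt_eqF.
  by apply; exists i; rewrite mulf_neq0// invr_eq0 gt_eqF.
have Fle y : F y <= 0.
  have [[i yi]|y0] := pselect (exists i, y i != 0).
    by rewrite ltW// Fneg//; exists i.
  rewrite /F big1// => i _; rewrite big1// => j _.
  have [->|yi] := eqVneq (y i) 0; first by rewrite !mul0r.
  by case: y0; exists i.
pose N := \sum_j (a j ^+ 2 + b j ^+ 2) / p j.
have FN : F a + F b = r * N.
  rewrite !FE -big_split mulr_sumr; apply: eq_bigr => j _ /=.
  by rewrite Ea Eb; ring.
have N0 : 0 <= N.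
  by apply: sumr_ge0 => j _; rewrite divr_ge0 ?addr_ge0 ?sqr_ge0// ltW.
suff Flt : F a + F b < 0.
  by rewrite ltNge; apply/negP => r0; have := mulr_ge0 r0 N0; lra.
have /rV0Pn[i ui] := u0.
have [ai|ai] := eqVneq (a i) 0; last first.
  by have := Fle b; have := Fneg _ (ex_intro _ i ai); lra.
have bi : b i != 0.
  by apply: contraNneq ui => bi; rewrite eq_complex -/(a i) -/(b i) ai bi !eqxx.
by have := Fle a; have := Fneg _ (ex_intro _ i bi); lra.
Qed.

(** The two sides differ by a sum over the columns [j] of [B]: the square of
    [p_i |b_ij| x_i - q_j x_j] divided by [q_j] if [i] is the row of the only
    nonzero entry, and [q_j x_j^2] if the column vanishes. *)
Lemma riccati_form_bound (R : realType) n (A B : 'M[R]_n) (p q x : 'I_n -> R) :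
  mono_columns B -> (forall i, 0 < p i) -> (forall i, 0 < q i) ->
  2 * (\sum_i \sum_j p i * (A + barmx B) i j * x i * x j)
    <= riccati_form A B p q x.
Proof.
move=> hB p0 q0; rewrite /riccati_form.
have col j : 2 * (\sum_i p i * `|B i j| * x i * x j) <=
    \sum_i (p i * B i j * x i) ^+ 2 / q j + q j * x j ^+ 2.
  have [/existsP[i Bij]|/existsPn B0] := boolP [exists i, B i j != 0].
    have B0 k : k != i -> B k j = 0.
      move=> ki; apply/eqP; apply: contraNT ki => Bkj; apply/eqP; exact: hB Bkj Bij.
    rewrite (bigD1 i)//= big1 => [|k ki]; last by rewrite B0// normr0 !(mulr0, mul0r).
    rewrite [X in _ <= X + _](bigD1 i)//= [X in _ <= _ + X + _]big1 => [|k ki]; last first.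
      by rewrite B0// !(mulr0, mul0r) expr0n mul0r.
    rewrite !addr0.
    have -> : (p i * B i j * x i) ^+ 2 = (p i * `|B i j| * x i) ^+ 2.
      by rewrite !exprMn real_normK// num_real.
    set y := p i * _ * x i.
    have -> : y ^+ 2 / q j + q j * x j ^+ 2 =
        2 * (y * x j) + (y - q j * x j) ^+ 2 / q j by field; rewrite gt_eqF.
    by rewrite lerDl divr_ge0 ?sqr_ge0// ltW.
  rewrite big1 ?mulr0 => [|i _].
    apply: addr_ge0; last by apply: mulr_ge0 (sqr_ge0 _); exact: ltW.
    by apply: sumr_ge0 => i _; rewrite divr_ge0 ?sqr_ge0// ltW.
  by have := B0 i; rewrite negbK => /eqP ->; rewrite normr0 !(mulr0, mul0r).
under [X in _ <= X + _]eq_bigr do rewrite big_split.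
rewrite big_split /= [X in _ + X + _]exchange_big /= -addrA -big_split /=.
rewrite mulr_sumr.
under [leLHS]eq_bigr do rewrite mulr_sumr.
apply: le_trans (lerD (lexx _) (ler_sum _ (fun j _ => col j))).
under [X in _ <= _ + X]eq_bigr do rewrite mulr_sumr.
rewrite [X in _ <= _ + X]exchange_big -big_split /=.
apply: ler_sum => i _; rewrite -big_split; apply: ler_sum => j _ /=.
by rewrite !mxE; lra.
Qed.

(** * Sign changes taking [A] to [hatmx A] *)

(** The diagonal entries are excluded because conjugation by signs leaves them
    unchanged, as [hatmx] does. *)
Definition sign_similar_hat (R : realType) n (A : 'M[R]_n) :=
  exists s : 'I_n -> R,
    (forall i, s i * s i = 1) /\
    (forall i j, i != j -> s i * A i j * s j = `|A i j|).

Lemma riccati_form_flip (R : realType) n (A B : 'M[R]_n) (p q x s : 'I_n -> R) :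
  (forall i, s i * s i = 1) ->
  (forall i j, i != j -> s i * A i j * s j = `|A i j|) ->
  riccati_form A B p q (fun i => s i * x i) = riccati_form (hatmx A) B p q x.
Proof.
move=> ss sA; rewrite /riccati_form; congr (_ + _).
  apply: eq_bigr => i _; apply: eq_bigr => j _; congr (2 * _ + _ / _).
    have -> : hatmx A i j = s i * A i j * s j; last by ring.
    rewrite mxE; have [<-|ij] := eqVneq i j; last by rewrite sA.
    by rewrite mulrAC ss mul1r.
  by rewrite mulrCA exprMn [s i ^+ 2]ss mul1r.
by apply: eq_bigr => j _; rewrite exprMn [s j ^+ 2]ss mul1r.
Qed.

Lemma riccati_stable_hurwitz (R : realType) n (A B : 'M[R]_n) :
  mono_columns B -> sign_similar_hat A -> diag_riccati_stable A B ->
  hurwitz (hatmx A + barmx B).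
Proof.
move=> hB [s [ss sA]] /(diag_riccati_stableP _ hB)[p [q [p0 q0 neg]]].
apply: (lyapunov_hurwitz p0) => x [i xi].
have /neg : exists k, s k * x k != 0.
  exists i; rewrite mulf_neq0//; apply: contraTneq (oner_neq0 R) => si.
  by rewrite -(ss i) si mulr0 eqxx.
rewrite riccati_form_flip// => negx.
by have := riccati_form_bound (hatmx A) x hB p0 q0; lra.
Qed.

Lemma metzler_sign_similar (R : realType) n (A : 'M[R]_n) :
  metzler A -> sign_similar_hat A.
Proof.
move=> mA; exists (fun=> 1); split=> [i|i j ij]; first by rewrite mulr1.
by rewrite mul1r mulr1 ger0_norm// mA.
Qed.

(** Walking along the path [0, 1, ..., n-1], the sign changes across the edge
    [{k, k+1}] exactly when one of its two entries is negative; the condition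
    [l_k u_k >= 0] makes this choice right for both entries. *)
Lemma tridiag_sign_similar (R : realType) n (A : 'M[R]_n) :
  sign_sym_tridiag A -> sign_similar_hat A.
Proof.
move=> [A0 Asym].
pose f (k : nat) : R := if [exists i : 'I_n, exists j : 'I_n,
  [&& i == k :> nat, j == k.+1 :> nat & (A i j < 0) || (A j i < 0)]]
  then -1 else 1.
have ff k : f k * f k = 1 by rewrite /f; case: ifP => _; rewrite ?mulrNN mulr1.
have fA (i j : 'I_n) : j = i.+1 :> nat ->
    f i * A i j = `|A i j| /\ f i * A j i = `|A j i|.
  move=> ji; have := Asym _ _ ji; rewrite /f; case: ifP.
    move=> /existsP[i' /existsP[j' /and3P[/eqP/val_inj -> /eqP j'i]]].
    have -> : j' = j by apply: val_inj; rewrite /= j'i ji.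
    move=> neg pos; have [h1 h2] : A i j <= 0 /\ A j i <= 0.
      by case/orP: neg => h; split; nra.
    by rewrite !mulN1r !ler0_norm.
  move=> /existsPn/(_ i)/existsPn/(_ j); rewrite ji !eqxx /= negb_or -!leNgt.
  by move=> /andP[h1 h2] _; rewrite !mul1r !ger0_norm.
pose s (i : 'I_n) := \prod_(k < i) f k.
have ss i : s i * s i = 1 by rewrite -big_split big1 //= => k _; exact: ff.
have sS (i j : 'I_n) : j = i.+1 :> nat -> s j = s i * f i.
  by move=> ji; rewrite /s ji big_ord_recr.
exists s; split=> // i j ij.
have [ji|ji] := eqVneq (j : nat) i.+1.
  have [<- _] := fA _ _ ji; rewrite (sS _ _ ji).
  by rewrite -[RHS]mul1r -(ss i); ring.
have [ij1|ij1] := eqVneq (i : nat) j.+1.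
  have [_ <-] := fA _ _ ij1; rewrite (sS _ _ ij1).
  by rewrite -[RHS]mul1r -(ss j); ring.
rewrite A0 ?normr0 ?mulr0 ?mul0r//.
by move: ij ji ij1; rewrite -val_eqE /=; lia.
Qed.

(** The last index keeps the sign [1] and every other index takes the sign of
    its entry in the last row, or [1] if that entry is zero. *)
Lemma last_row_sign_similar (R : realType) n (A : 'M[R]_n) :
  diag_plus_last_row A -> sign_similar_hat A.
Proof.
move=> A0.
pose s (j : 'I_n) : R :=
  if [exists i : 'I_n, [&& i.+1 == n, i != j & A i j < 0]] then -1 else 1.
exists s; split=> [i|i j ij].
  by rewrite /s; case: ifP => _; rewrite ?mulrNN mulr1.
have [iN|iN] := eqVneq i.+1 n; last by rewrite A0// normr0 mulr0 mul0r.
have last_uniq (k : 'I_n) : k.+1 == n -> k = i.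
  by move=> /eqP kN; apply: val_inj; apply: succn_inj; rewrite kN.
have -> : s i = 1.
  rewrite /s; case: ifP => // /existsP[k /and3P[/last_uniq -> ]].
  by rewrite eqxx.
rewrite mul1r /s; case: ifP => [/existsP[k /and3P[/last_uniq -> _ neg]]|].
  by rewrite mulrN1 ltr0_norm.
move=> /existsPn/(_ i); rewrite iN eqxx ij /= -leNgt => pos.
by rewrite mulr1 ger0_norm.
Qed.

Theorem proposition3p5 (R : realType) (n : nat) (A B : 'M[R]_n)
  (hA : metzler A \/ sign_sym_tridiag A \/ diag_plus_last_row A)
  (hB : superdiagonal B) :
  diag_riccati_stable A B <-> hurwitz (hatmx A + barmx B).
Proof.
have mB := superdiagonal_mono_columns hB.
split=> [|/hurwitz_riccati_form]; last by move/(diag_riccati_stableP A mB).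
apply: riccati_stable_hurwitz => //; case: hA => [|[]].
- exact: metzler_sign_similar.
- exact: tridiag_sign_similar.
- exact: last_row_sign_similar.
Qed.
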